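(* For every $k\ge 2$, the ideal $I_k\subset R_k$ has exactly $3$ minimal generators.
   Context: $\mathbb F$ is a field of characteristic $\neq 2$. For $k\ge 2$, $R_k$ is the polynomial ring over $\mathbb F$ in the $3k$ variables $v_{i,c}$ ($1\le i\le k$, $c=1,2,3$), with its standard grading, and $\overline v_i=(v_{i,1},v_{i,2},v_{i,3})\in R_k^3$. Let $S=\mathrm{diag}(-1,-1,1)$ and let $a\times b=(a_2b_3-a_3b_2,\;a_3b_1-a_1b_3,\;a_1b_2-a_2b_1)$ be the cross product. Define recursively $\overline w_2=\overline v_1\times\overline v_2$ and $\overline w_j=S(\overline w_{j-1})\times\overline v_j$ for $j\ge 3$. $I_k\subset R_k$ is the ideal generated by the three components of $\overline w_k$, which are homogeneous of degree $k$. The number of minimal generators of a homogeneous ideal is the cardinality of any minimal homogeneous generating set. *)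

(* Defs.v *)
From mathcomp Require Import all_boot all_algebra.
From mathcomp Require Import classical_sets cardinality.
From mathcomp Require Export mpoly.

Set Implicit Arguments.
Unset Strict Implicit.
Unset Printing Implicit Defensive.

Import GRing.Theory.
Local Open Scope classical_set_scope.
Local Open Scope card_scope.
Local Open Scope ring_scope.

Section Vectors.
Variable A : comNzRingType.

(* The coordinates 1, 2, 3 are the ordinals 0, 1, 2 of 'I_3. *)
Definition cross (a b : 'cV[A]_3) : 'cV[A]_3 :=
  \col_c [:: a 1 0 * b 2 0 - a 2 0 * b 1 0;
             a 2 0 * b 0 0 - a 0 0 * b 2 0;
             a 0 0 * b 1 0 - a 1 0 * b 0 0]`_c.

Definition Smx : 'M[A]_3 := diag_mx (\row_c [:: -1; -1; 1]`_c).

(* The meaningful indices are j >= 2; the values at 0 and 1 are both 0. *)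
Fixpoint wvec (v : nat -> 'cV[A]_3) (j : nat) : 'cV[A]_3 :=
  if j is i.+1 then
    if i == 1%N then cross (v 1%N) (v 2%N)
    else cross (Smx *m wvec v i) (v i.+1)
  else 0.

End Vectors.

Section Ideals.
Variable A : comNzRingType.

Definition ideal_gen (G : set A) : set A :=
  [set p | exists s : seq (A * A),
      (forall x, x \in s -> G x.2) /\ p = \sum_(x <- s) x.1 * x.2].

End Ideals.

Section MinimalGenerators.
Variables (n : nat) (F : fieldType).
Implicit Types (I G H : set {mpoly F[n]}).

Definition homogeneous_generating_set I G : Prop :=
  (forall g, G g -> exists d : nat, g \is d.-homog) /\ ideal_gen G = I.

Definition minimal_homogeneous_generating_set I G : Prop :=
  homogeneous_generating_set I G /\
  forall H, H `<=` G -> homogeneous_generating_set I H -> H = G.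

(* The cardinality of any minimal homogeneous generating set is m; existence
   of such a set is included so that the assertion is not vacuous. *)
Definition num_minimal_generators I (m : nat) : Prop :=
  (exists G, minimal_homogeneous_generating_set I G) /\
  (forall G, minimal_homogeneous_generating_set I G -> G #= `I_m).

End MinimalGenerators.

Section IdealI.
Variables (F : fieldType) (k : nat).

(* 'X_(mxvec_index i c), with i : 'I_k and c : 'I_3, is v_{i+1,c+1}. The index
   of vbar is 1-based; only 1 <= i <= k is meaningful. *)
Definition vbar (i : nat) : 'cV[{mpoly F[k * 3]}]_3 :=
  \col_c (if insub i.-1 is Some i' then 'X_(mxvec_index (i' : 'I_k) c) else 0).

Definition idealI : set {mpoly F[k * 3]} :=
  ideal_gen (range (fun c : 'I_3 => wvec vbar k c 0)).

End IdealI.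

Arguments vbar : clear implicits.
Arguments idealI : clear implicits.

(* Main.v *)
Require Import Defs.
From mathcomp Require Import all_boot all_algebra.
From mathcomp Require Import boolp classical_sets cardinality.

Set Implicit Arguments.
Unset Strict Implicit.
Unset Printing Implicit Defensive.

Import GRing.Theory.
Local Open Scope classical_set_scope.
Local Open Scope card_scope.
Local Open Scope ring_scope.

(** The three components of [wvec (vbar F k) k] are forms of the same degree [k],
    and they are linearly independent over [F]: the polynomial map [wvec] takes
    each of the three standard basis vectors as a value at some point
    ([wvec_basis_vec]), so evaluating a relation between the components at these
    three points kills its coefficients one by one ([wvec_free]). The basis
    vectors are reached by induction: each of them is the cross product of the
    other two, taken in cyclic order, and the matrix [Smx] only changes their
    signs, which the new factor can absorb.

    The rest is a graded Nakayama argument, for [r] linearly independent forms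
    [w] of degree [d] generating an ideal I. Taking components of degree [d] maps
    I onto the span of [w], and multiplication by a polynomial acts there as
    multiplication by its constant term ([pihomogM_ideal]). Hence the degree [d]
    components of any homogeneous generating set span an [r]-dimensional space;
    [r] elements of the set already give a basis of it, and being homogeneous
    they are equal to their components of degree [d]. So every homogeneous
    generating set contains [r] elements that generate I
    ([generating_set_contains_basis]). A minimal one must consist of exactly
    these, and the [w] themselves are minimal because any generating subset of
    them has at least [r] elements. *)

(** * Ideals generated by a set *)

Section IdealGen.
Variable A : comNzRingType.
Implicit Types (G H : set A) (p q : A).

Lemma mem_ideal_gen G p : G p -> ideal_gen G p.
Proof.
move=> Gp; exists [:: (1, p)]; split; last by rewrite big_seq1 mul1r.
by move=> x; rewrite inE => /eqP ->.
Qed.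

Lemma ideal_gen0 G : ideal_gen G 0.
Proof. by exists [::]; split=> //; rewrite big_nil. Qed.

Lemma ideal_genD G p q : ideal_gen G p -> ideal_gen G q -> ideal_gen G (p + q).
Proof.
move=> [s [Gs ->]] [t [Gt ->]]; exists (s ++ t); rewrite big_cat; split=> // x.
by rewrite mem_cat => /orP[/Gs|/Gt].
Qed.

Lemma ideal_genMl G a p : ideal_gen G p -> ideal_gen G (a * p).
Proof.
move=> [s [Gs ->]]; exists [seq (a * x.1, x.2) | x <- s]; split.
  by move=> _ /mapP[x /Gs Gx ->].
by rewrite big_map mulr_sumr; apply: eq_bigr => x _; rewrite mulrA.
Qed.

Lemma ideal_gen_sum G (J : eqType) (s : seq J) (f : J -> A) :
  (forall j, j \in s -> ideal_gen G (f j)) -> ideal_gen G (\sum_(j <- s) f j).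
Proof.
move=> Gf; rewrite big_seq.
by elim/big_ind: _ => // [|p q]; [apply: ideal_gen0 | apply: ideal_genD].
Qed.

Lemma ideal_gen_sub G H : G `<=` ideal_gen H -> ideal_gen G `<=` ideal_gen H.
Proof.
move=> GH _ [s [Gs ->]]; apply: ideal_gen_sum => x /Gs Gx.
exact/ideal_genMl/GH.
Qed.

Lemma ideal_gen_range r (w : 'I_r -> A) p :
  ideal_gen (range w) p -> exists b : 'I_r -> A, p = \sum_i b i * w i.
Proof.
move=> [s [+ ->]]; elim: s => [|x s IHs] ws.
  by exists (fun=> 0); rewrite big_nil big1 // => i _; rewrite mul0r.
have [|b Eb] := IHs; first by move=> y ys; apply: ws; rewrite inE ys orbT.
have [i _ Ei] := ws x (mem_head _ _).
exists (fun j => (if j == i then x.1 else 0) + b j).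
rewrite big_cons Eb -Ei; under [RHS]eq_bigr do rewrite mulrDl.
rewrite big_split /=; congr (_ + _).
by rewrite (bigD1 i) //= eqxx big1 ?addr0 // => j /negPf->; rewrite mul0r.
Qed.

End IdealGen.

(** * Families indexed by ordinals *)

Lemma card_range_ord r (T : Type) (g : 'I_r -> T) : injective g -> range g #= `I_r.
Proof.
move=> g_inj; apply: (@card_eq_trans _ _ _ _ [set: 'I_r]).
  by apply: inj_card_eq => i j _ _; apply: g_inj.
have -> : `I_r = val @` [set: 'I_r].
  apply/seteqP; split=> [i lt_ir|_ [i _ <-]]; last exact: ltn_ord.
  by exists (Ordinal lt_ir).
by rewrite card_eq_sym; apply: inj_card_eq => i j _ _; apply: val_inj.
Qed.

(** Both families have at most [r] values, and [g] has exactly [r] of them. *)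
Lemma range_sub_inj r (T : Type) (g g' : 'I_r -> T) :
  injective g -> range g `<=` range g' -> range g = range g'.
Proof.
move=> g_inj gg'; have /choice[s sP] i : exists j, g' j = g i.
  by have [j _ <-] : range g' (g i) by [apply: gg'; exists i]; exists j.
have s_inj : injective s by move=> i j sij; apply: g_inj; rewrite -!sP sij.
apply/seteqP; split=> // _ [j _ <-].
by exists (invF s_inj j) => //; rewrite -sP f_invF.
Qed.

(** * Ideals generated by linearly independent forms of one degree *)

Section EquigeneratedIdeal.
Variables (n r d : nat) (F : fieldType) (w : 'I_r -> {mpoly F[n]}).
Implicit Types (p q a : {mpoly F[n]}) (H : set {mpoly F[n]}).
Hypothesis w_homog : forall i, w i \is d.-homog.
Hypothesis w_free : forall l : 'I_r -> F, \sum_i l i *: w i = 0 -> l =1 fun=> 0.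

Local Notation top := (pihomog [measure of mdeg] d).
Local Notation I := (ideal_gen (range w)).

(** A nonconstant monomial of [a] moves [p] to a degree greater than [d]. *)
Lemma pihomogM_homog a p :
  p \is d.-homog -> top (a * p) = a@_0 *: p.
Proof.
move=> hp; rewrite {1}(mpolyE a) mulr_suml (linear_sum top).
have mono m : top (a@_m *: 'X_[m] * p) =
              if m == 0%MM then a@_0 *: p else 0.
  rewrite -scalerAl linearZ /=; case: eqP => [->|/eqP m0].
    by rewrite mpolyX0 mul1r pihomog_dE.
  rewrite (@pihomog_ne0 _ _ _ (mdeg m + d)) ?scaler0 //; last first.
    by apply: dhomogM => //; rewrite dhomogX.
  by rewrite -[X in _ != X]add0n eqn_add2r mdeg_eq0.
rewrite (eq_bigr _ (fun m _ => mono m)).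
have [a0|/memN_msupp_eq0 a0] := boolP (0%MM \in msupp a); last first.
  by rewrite a0 scale0r big1 // => m _; rewrite if_same.
rewrite (bigD1_seq 0%MM) ?msupp_uniq //= eqxx big1 ?addr0 // => m /negPf->.
by [].
Qed.

(** Elements of the ideal have no component of degree less than [d], so the
    degree [d] component of a product only sees the constant term of [a]. *)
Lemma pihomogM_ideal a p : I p ->
  top (a * p) = a@_0 *: top p.
Proof.
case/ideal_gen_range => b ->; rewrite mulr_sumr !(linear_sum top) scaler_sumr.
apply: eq_bigr => i _.
by rewrite /= mulrA !pihomogM_homog // mcoeff0_is_multiplicative scalerA.
Qed.

Lemma pihomog_ideal p : I p ->
  exists l : 'I_r -> F, top p = \sum_i l i *: w i.
Proof.
case/ideal_gen_range => b ->; exists (fun i => (b i)@_0).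
by rewrite (linear_sum top); apply: eq_bigr => i _; rewrite /= pihomogM_homog.
Qed.

Lemma free_coef_inj (l l' : 'I_r -> F) :
  \sum_i l i *: w i = \sum_i l' i *: w i -> l =1 l'.
Proof.
move=> /eqP; rewrite -subr_eq0 -sumrB => /eqP.
under eq_bigr do rewrite -scalerBl.
by move=> /w_free E i; apply/eqP; rewrite -subr_eq0 E.
Qed.

(** The matrix [M] below expresses the degree [d] components of finitely many
    elements of [H] in terms of [w]. Writing each [w i] with these elements and
    taking degree [d] components gives a left inverse of [M], by uniqueness of
    coordinates; thus [M] has rank [r], and [r] of its rows form an invertible
    matrix. *)
Lemma generating_set_contains_basis H :
    homogeneous_generating_set I H ->
  exists g : 'I_r -> {mpoly F[n]},
    [/\ injective g, range g `<=` H & homogeneous_generating_set I (range g)].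
Proof.
move=> [Hhom HI].
have HsubI p : H p -> I p by move=> Hp; rewrite -HI; apply: mem_ideal_gen.
have /choice[s sP] i : exists s : seq ({mpoly F[n]} * {mpoly F[n]}),
    (forall x, x \in s -> H x.2) /\ w i = \sum_(x <- s) x.1 * x.2.
  by have : I (w i) by [apply: mem_ideal_gen; exists i]; rewrite -HI.
(* All elements of [H] that occur in the chosen expressions of the [w i]. *)
pose hs := undup (flatten [seq [seq x.2 | x <- s i] | i : 'I_r]).
have sub_hs i x : x \in s i -> x.2 \in hs.
  move=> xs; rewrite mem_undup; apply/flatten_mapP.
  by exists i; [rewrite mem_enum | apply: map_f].
have hsH p : p \in hs -> H p.
  rewrite mem_undup => /flatten_mapP[i _ /mapP[x xs ->]].
  by have [+ _] := sP i; apply.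
pose m := size hs; pose h (j : 'I_m) := hs`_j.
have hH j : H (h j) by apply/hsH/mem_nth.
have /choice[l lP] (j : 'I_m) : exists l : 'I_r -> F,
    top (h j) = \sum_i l i *: w i.
  exact/pihomog_ideal/HsubI.
pose M : 'M[F]_(m, r) := \matrix_(j, i) l j i.
have M_full : row_full M.
  apply/row_fullP.
  (* An element of [H] may occur several times in [s i]: the constant terms of
     its coefficients add up. *)
  exists (\matrix_(i, j) \sum_(x <- s i | x.2 == h j) (x.1)@_0).
  apply/matrixP => i i'; rewrite !mxE.
  have Ew : w i = \sum_i'
      (\sum_j (\sum_(x <- s i | x.2 == h j) (x.1)@_0) * l j i') *: w i'.
    have [_ Ei] := sP i; rewrite -{1}(pihomog_dE (w_homog i)) Ei (linear_sum top).
    transitivity (\sum_(x <- s i) \sum_(j | x.2 == h j)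
                    (x.1)@_0 *: top (h j)).
      rewrite big_seq [RHS]big_seq; apply: eq_bigr => x xs.
      have x2 := sub_hs _ _ xs.
      rewrite /= pihomogM_ideal; last exact/HsubI/hsH.
      have lt_j : (index x.2 hs < m)%N by rewrite index_mem.
      rewrite (big_pred1 (Ordinal lt_j)) /h /= ?nth_index // => j.
      rewrite -[RHS]val_eqE /=; apply/eqP/eqP => [->|->]; last by rewrite nth_index.
      by rewrite index_uniq ?undup_uniq.
    under eq_bigr do rewrite big_mkcond.
    rewrite exchange_big /=; under [RHS]eq_bigr do rewrite scaler_suml.
    rewrite [RHS]exchange_big /=; apply: eq_bigr => j _.
    rewrite -big_mkcond -scaler_suml lP scaler_sumr.
    by apply: eq_bigr => t _; rewrite scalerA.
  have Ew1 : w i = \sum_t (i == t)%:R *: w t.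
    rewrite (bigD1 i) //= eqxx scale1r big1 ?addr0 // => t.
    by rewrite eq_sym => /negPf->; rewrite scale0r.
  rewrite (free_coef_inj (etrans (esym Ew1) Ew) i').
  by apply: eq_bigr => j _; rewrite !mxE.
pose f := fullrankfun M_full.
have fM : rowsub f M \in unitmx by apply: fullrowsub_unit.
have w_pi i : w i = \sum_t invmx (rowsub f M) i t *:
    top (h (f t)).
  under eq_bigr do rewrite lP scaler_sumr.
  rewrite exchange_big /= (bigD1 i) //= [X in _ + X]big1 ?addr0 => [|t nit].
    under eq_bigr do rewrite scalerA.
    rewrite -scaler_suml.
    have /matrixP/(_ i i) := mulVmx fM; rewrite !mxE eqxx.
    by under eq_bigr do rewrite !mxE; move->; rewrite scale1r.
  under eq_bigr do rewrite scalerA.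
  rewrite -scaler_suml.
  have /matrixP/(_ i t) := mulVmx fM; rewrite !mxE eq_sym (negPf nit).
  by under eq_bigr do rewrite !mxE; move->; rewrite scale0r.
(* In a degree other than [d], [h (f t)] would have zero component of degree [d],
   hence give a zero row in an invertible matrix. *)
have pi_h t : top (h (f t)) = h (f t).
  have [e he] := Hhom _ (hH (f t)).
  have [<-|ned] := eqVneq e d; first exact: pihomog_dE.
  have l0 : l (f t) =1 fun=> 0.
    by apply: w_free; rewrite -lP (pihomog_ne0 ned).
  have : row t (rowsub f M) == 0.
    by apply/eqP/rowP => i; rewrite !mxE l0.
  have := fM; rewrite -row_free_unit => /row_freeP[N MN] /eqP row0.
  have /eqP := congr1 (row t) MN; rewrite row_mul row0 mul0mx.
  move=> /eqP/rowP/(_ t)/eqP; rewrite !mxE eqxx eq_sym.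
  by rewrite oner_eq0.
exists (h \o f); split.
- move=> t t' /= /eqP; rewrite /h nth_uniq ?undup_uniq //.
  by move=> /eqP/val_inj/fullrankfun_inj.
- by move=> _ [t _ <-] /=.
split; first by move=> _ [t _ <-]; apply: Hhom (hH _).
apply/seteqP; split; first by apply: ideal_gen_sub => _ [t _ <-]; exact/HsubI/hH.
apply: ideal_gen_sub => _ [i _ <-]; rewrite w_pi.
apply: ideal_gen_sum => t _; rewrite pi_h -mul_mpolyC; apply: ideal_genMl.
by apply: mem_ideal_gen; exists t.
Qed.

(** The set [range w] is minimal because a generating subset of it contains [r]
    distinct elements, which is all of [range w]. *)
Lemma num_minimal_generators_equigenerated : num_minimal_generators I r.
Proof.
split=> [|G [G_gen G_min]]; last first.
  have [g [g_inj gG /(G_min _ gG) <-]] := generating_set_contains_basis G_gen.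
  exact: card_range_ord.
exists (range w); split=> [|H Hw H_gen].
  by split=> // _ [i _ <-]; exists d.
have [g [g_inj gH _]] := generating_set_contains_basis H_gen.
apply/seteqP; split=> //.
by rewrite -(range_sub_inj g_inj (subset_trans gH Hw)).
Qed.

End EquigeneratedIdeal.

(** * Values of the iterated cross product *)

Section WvecValues.
Variable A : comNzRingType.

Lemma eq_wvec (v v' : nat -> 'cV[A]_3) j :
  (forall i, (0 < i <= j)%N -> v i = v' i) -> wvec v j = wvec v' j.
Proof.
elim: j => //= j IHj vv'; case: eqP => [j1|_].
  by rewrite !vv' ?j1.
rewrite vv' ?leqnn // IHj // => i /andP[i_gt0 le_ij].
by rewrite vv' // i_gt0 ltnW.
Qed.

Local Notation basis_vec c := (delta_mx c 0 : 'cV[A]_3).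

(** Addition in ['I_3] is modulo 3, so this covers the three cyclic cases. *)
Lemma basis_vec_cross (c : 'I_3) :
  cross (basis_vec (c + 1)) (basis_vec (c + 2%:R)) = basis_vec c.
Proof.
apply/colP => i; rewrite !mxE.
by case: c => [[|[|[|]]]] // ?; case: i => [[|[|[|]]]] // ? /=;
   rewrite ?(mulr1, mulr0, mul0r, subr0).
Qed.

Lemma crossNN (a b : 'cV[A]_3) : cross (- a) (- b) = cross a b.
Proof. by apply/colP => i; rewrite !mxE !mulrNN. Qed.

Lemma Smx_basis_vec (c : 'I_3) :
  Smx A *m basis_vec c = basis_vec c \/ Smx A *m basis_vec c = - basis_vec c.
Proof.
have E : Smx A *m basis_vec c = [:: -1; -1; 1]`_c *: basis_vec c.
  apply/colP => i; rewrite mul_diag_mx !mxE.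
  by case: eqP => [->|_]; rewrite ?mulr0.
rewrite E; case: c {E} => [[|[|[|]]]] //= ?.
- by right; rewrite scaleN1r.
- by right; rewrite scaleN1r.
- by left; rewrite scale1r.
Qed.

(** To reach [delta_mx c 0] at the next step, arrive at the next basis vector in
    the cyclic order and take the last factor to be the remaining one, with the
    sign by which [Smx] acts. *)
Lemma wvec_basis_vec j (c : 'I_3) :
  (1 < j)%N -> exists v : nat -> 'cV[A]_3, wvec v j = basis_vec c.
Proof.
case: j => // j; elim: j => // j IHj in c *; rewrite ltnS => j_gt0.
have [j1|j_gt1] := eqVneq j 0%N.
  exists (fun i => if i == 1%N then basis_vec (c + 1) else basis_vec (c + 2%:R)).
  by rewrite j1 /= basis_vec_cross.
have [|v vj] := IHj (c + 1); first by rewrite ltnS lt0n.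
pose upd u i := if i == j.+2 then u else v i.
have upd_lt u : wvec (upd u) j.+1 = basis_vec (c + 1).
  rewrite -vj; apply: eq_wvec => i /andP[_ le_ij].
  by rewrite /upd ltn_eqF.
have step u : wvec (upd u) j.+2 = cross (Smx A *m basis_vec (c + 1)) u.
  by rewrite -(upd_lt u) [LHS]/= eqSS (negPf j_gt1) [upd _ j.+2]/upd eqxx.
have [S1|S1] := Smx_basis_vec (c + 1).
  by exists (upd (basis_vec (c + 2%:R))); rewrite step S1 basis_vec_cross.
exists (upd (- basis_vec (c + 2%:R))).
by rewrite step S1 crossNN basis_vec_cross.
Qed.

End WvecValues.

Lemma map_cross (A B : comNzRingType) (f : {rmorphism A -> B}) (a b : 'cV[A]_3) :
  map_mx f (cross a b) = cross (map_mx f a) (map_mx f b).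
Proof.
apply/colP => i; rewrite !mxE; case: i => [[|[|[|]]]] //= ?;
  by rewrite rmorphB !rmorphM.
Qed.

Lemma map_wvec (A B : comNzRingType) (f : {rmorphism A -> B})
    (v : nat -> 'cV[A]_3) j :
  map_mx f (wvec v j) = wvec (map_mx f \o v) j.
Proof.
have fS : map_mx f (Smx A) = Smx B.
  rewrite map_diag_mx; congr diag_mx; apply/rowP => i; rewrite !mxE.
  by case: i => [[|[|[|]]]] //= ?; rewrite ?rmorphN rmorph1.
elim: j => [|j IHj] /=; first exact: map_mx0.
by case: ifP => _; rewrite map_cross // map_mxM fS IHj.
Qed.

(** * The components of the generic vector *)

Section GenericWvec.
Variables (F : fieldType) (k : nat).

(** The entries of [vbar] are independent variables, so any [k] vectors are a
    specialization of it. *)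
Lemma meval_vbar (v : nat -> 'cV[F]_3) : exists x : 'I_(k * 3) -> F,
  forall i, (0 < i <= k)%N -> map_mx (meval x) (vbar F k i) = v i.
Proof.
exists (fun t => mxvec (\matrix_(i < k, c < 3) v i.+1 c 0) 0 t) => -[|i] // ltik.
apply/colP => c; rewrite !mxE /= insubT /= mevalXU.
by rewrite mxvecE mxE.
Qed.

(** At a point where [wvec] is the basis vector of index [c], the relation reads
    [l c = 0]. *)
Lemma wvec_free : (1 < k)%N -> forall l : 'I_3 -> F,
  \sum_c l c *: wvec (vbar F k) k c 0 = 0 -> l =1 fun=> 0.
Proof.
move=> k_gt1 l l0 c; have [v vk] := wvec_basis_vec F c k_gt1.
have [x xv] := meval_vbar v.
have wx : map_mx (meval x) (wvec (vbar F k) k) = delta_mx c 0.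
  by rewrite map_wvec -vk; apply: eq_wvec => i /xv.
have /(congr1 (meval x)) := l0; rewrite raddf0 raddf_sum /=.
under eq_bigr => i _.
  have /colP/(_ i) := wx; rewrite !mxE mevalZ => ->; over.
rewrite (bigD1 c) //= eqxx mulr1 big1 ?addr0 // => i /negPf->.
by rewrite mulr0.
Qed.

Lemma cross_homog n d e (a b : 'cV[{mpoly F[n]}]_3) :
    (forall c, a c 0 \is d.-homog) -> (forall c, b c 0 \is e.-homog) ->
  forall c, cross a b c 0 \is (d + e).-homog.
Proof.
move=> ha hb c; rewrite mxE.
by case: c => [[|[|[|]]]] //= ?; apply: rpredB; apply: dhomogM.
Qed.

(** For [j <= 1] the vector is zero, and zero is homogeneous of every degree. *)
Lemma wvec_homog n (v : nat -> 'cV[{mpoly F[n]}]_3) :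
    (forall i c, v i c 0 \is 1.-homog) ->
  forall j c, wvec v j c 0 \is j.-homog.
Proof.
move=> hv; elim=> [|j IHj] c /=; first by rewrite mxE rpred0.
case: eqP => [->|_]; first exact: (@cross_homog _ 1 1).
rewrite -(addn1 j); apply: cross_homog => // i.
rewrite mul_diag_mx !mxE.
by case: i => [[|[|[|]]]] //= ?; rewrite ?mulN1r ?mul1r ?rpredN.
Qed.

Lemma vbar_homog i c : vbar F k i c 0 \is 1.-homog.
Proof.
rewrite mxE; case: insub => [t|]; last exact: rpred0.
by rewrite dhomogX /= mdeg1.
Qed.

End GenericWvec.

Local Close Scope ring_scope.
Local Close Scope card_scope.
Local Close Scope classical_set_scope.

Theorem theorem12 (F : fieldType) (hF : 2 \notin [pchar F]%R)
    (k : nat) (hk : 2 <= k) :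
  num_minimal_generators (idealI F k) 3.
Proof.
apply: (@num_minimal_generators_equigenerated _ _ k) => [c|l].
  exact/wvec_homog/vbar_homog.
exact: wvec_free.
Qed.
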